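(* Let $T$ be an expofam-type estimator on $\mathcal{X}$ with penalty support set $C$, and a generator $A$ that is closed, convex, proper and $\mathcal{G}$-invariant. Fix $x\in\mathcal{X}$. If $Q:\mathcal{X}\to\mathcal{X}$ is an orthogonal projection satisfying 1. (averaging) $Qu\preceq_{\mathcal{G}}u$ for all $u\in\mathcal{X}$, 2. (dual feasibility) $Q(x-C)\subseteq x-C$, and 3. (dual invariance) $Q(x-C)\subseteq Qx-C$, then $$Q\,T(x)=Q\,T(Qx)\subseteq T(x)\cap T(Qx).$$ In particular, if $T(x)$ is a singleton, then $$Q\,T(x)=Q\,T(Qx)=T(x)=T(Qx).$$
   Context: $\mathcal{X}$ is a Euclidean space with inner product $\langle\cdot,\cdot\rangle$, and $\mathcal{G}$ is a compact subgroup of the orthogonal group $\mathcal{O}(\mathcal{X})$ of $\mathcal{X}$, acting linearly on $\mathcal{X}$, written $g\cdot x$. A function $f$ on $\mathcal{X}$ is $\mathcal{G}$-invariant if $f(g\cdot x)=f(x)$ for all $x\in\mathcal{X}$ and $g\in\mathcal{G}$. The relation $v\preceq_{\mathcal{G}}u$ means $v\in\operatorname{conv}(\mathcal{G}\cdot u)$, where $\mathcal{G}\cdot u=\{g\cdot u:g\in\mathcal{G}\}$ and $\operatorname{conv}$ denotes the convex hull. An expofam-type estimator is a set-valued function $T$ on $\mathcal{X}$ of the form $T(x)=\operatorname{arg\,min}_{\theta}\,A(\theta)-\langle x,\theta\rangle+h_C(\theta)$ (the set of minimizers, which may be empty or have several elements), where the generator $A:\mathcal{X}\to\mathbb{R}\cup\{+\infty\}$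 is closed (lower semicontinuous), convex and proper (finite for at least one value in $\mathcal{X}$), the penalty support set $C\subseteq\mathcal{X}$ is nonempty, closed and convex, and $h_C:\mathcal{X}\to\mathbb{R}\cup\{+\infty\}$, $h_C(\theta)=\max_{z\in C}\langle z,\theta\rangle$, is the support function of $C$. For $S\subseteq\mathcal{X}$ and $y\in\mathcal{X}$: $QS=\{Qs:s\in S\}$ and $y-S=\{y-s:s\in S\}$.
   Formalization: The final equality T(x)=T(Qx) is false if only T(x) is a singleton (X=R, G={1,-1}, A=0, C=[0,1], Q=0, x=1/2); it is stated assuming T(Qx) is a singleton too, and otherwise only as T(x)⊆T(Qx). *)

(* Defs.v *)
From HB Require Import structures.
From mathcomp Require Import all_boot all_order all_algebra sesquilinear.
From mathcomp Require Import all_classical all_reals all_analysis.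

Set Implicit Arguments.
Unset Strict Implicit.
Unset Printing Implicit Defensive.

Import Order.TTheory GRing.Theory Num.Theory.
Import numFieldNormedType.Exports.

Local Open Scope classical_set_scope.
Local Open Scope ring_scope.

(* A Euclidean space is represented, in coordinates, as 'cV[R]_n with an
   arbitrary inner product [ip : {dot 'cV[R]_n for idfun}] (symmetric, bilinear,
   positive definite).  Every norm induces the library topology of 'cV[R]_n, so
   [closed], [compact] and [lower_semicontinuous] do not depend on [ip].
   Linear maps are matrices acting by [g *m u]. *)

Section Definitions.
Context {R : realType} {n : nat}.
Local Notation X := 'cV[R]_n.
Variable ip : {dot X for idfun}.

Definition orthogonal_group : set 'M[R]_n :=
  [set g | forall u v : X, ip (g *m u) (g *m v) = ip u v].

Definition compact_orthogonal_subgroup (G : set 'M[R]_n) : Prop :=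
  [/\ G `<=` orthogonal_group,
      G 1%:M,
      (forall g h, G g -> G h -> G (g *m h)),
      (forall g, G g -> G (invmx g)) &
      compact G].

Definition invariant_fun (G : set 'M[R]_n) (f : X -> \bar R) : Prop :=
  forall (x : X) (g : 'M[R]_n), G g -> f (g *m x) = f x.

Definition group_orbit (G : set 'M[R]_n) (u : X) : set X :=
  [set g *m u | g in G].

Definition conv_hull (S : set X) : set X :=
  smallest (fun K : set X => convex_set K) S.

Definition group_majorized (G : set 'M[R]_n) (v u : X) : Prop :=
  conv_hull (group_orbit G u) v.

Definition proper_fun (f : X -> \bar R) : Prop :=
  (forall x, f x != -oo%E) /\ (exists x, f x \is a fin_num).

(* Only meant for functions without the value -oo. *)
Definition convex_efun (f : X -> \bar R) : Prop :=
  forall (x y : X) (t : R), 0 < t -> t < 1 ->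
    (f (t *: x + (1 - t) *: y)%R
       <= t%:E * f x + (1 - t)%:E * f y)%E.

(* The "max" defining h_C is a supremum in R \cup {+oo}: it need not be
   attained when C is unbounded. *)
Definition support_fun (C : set X) (theta : X) : \bar R :=
  ereal_sup [set (ip z theta)%:E | z in C].

(* A minimizer has a finite value, so the identically +oo function has none. *)
Definition argmin (f : X -> \bar R) : set X :=
  [set theta | (f theta < +oo)%E /\ forall eta, (f theta <= f eta)%E].

Definition expofam_objective (A : X -> \bar R) (C : set X) (x theta : X)
    : \bar R :=
  (A theta - (ip x theta)%:E + support_fun C theta)%E.

Definition expofam_type (A : X -> \bar R) (C : set X) (T : X -> set X) : Prop :=
  [/\ [/\ lower_semicontinuous A, convex_efun A & proper_fun A],
      [/\ C !=set0, closed C & convex_set C] &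
      forall x, T x = argmin (expofam_objective A C x)].

Definition orthogonal_projection (Q : X -> X) : Prop :=
  exists W : {vspace X}, forall u,
    Q u \in W /\ (forall w, w \in W -> ip (u - Q u) w = 0).

Definition minus_set (y : X) (S : set X) : set X := [set y - s | s in S].

(* For an orthogonal projection Q satisfying averaging, dual feasibility and
   dual invariance at x, [T x] being a singleton does not force [T (Q x)] to be
   one.  On R, take G = {1, -1}, A = 0, C = [0, 1], Q = 0 and x = 1/2: then
   T x = {0}, the minimizers of |theta| / 2, while T (Q x) = ]-oo, 0], those of
   max(theta, 0). *)
Definition is_singleton (S : set X) : Prop := exists t, S = [set t].

End Definitions.

(* Main.v *)
Require Import Defs.
From HB Require Import structures.
From mathcomp Require Import all_boot all_order all_algebra sesquilinear.
From mathcomp Require Import all_classical all_reals all_analysis.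

Import Order.TTheory GRing.Theory Num.Theory.
Import numFieldNormedType.Exports.

Local Open Scope classical_set_scope.
Local Open Scope ring_scope.

(** Up to the generator, the objective at [x] sees the data only through the
    set [x - C]: [h_C theta - <x, theta>] is the support function of [x - C] at
    [- theta] ([expofam_objective_support]).  A self-adjoint [Q] moves from the
    argument of a support function to its set ([support_fun_self_adjoint]), so
    an inclusion [Q (y - C) <= z - C] makes the penalty at [y] of [Q theta] at
    most the penalty at [z] of [theta].  The generator does not increase under
    [Q] either: its sublevel sets are convex and [G]-stable, hence contain
    [Q u] with [u] ([convex_invariant_majorized]).

    Write [F_y] for the objective at [y].  Since [Q (Q x - C) = Q (x - C)], the
    two dual hypotheses provide the inclusion for all four choices of [y] and
    [z] in [{x, Q x}], that is [F_y (Q theta) <= F_z theta] for all of them.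
    A minimizer [theta] of [F_z] then satisfies
    [F_y (Q theta) <= F_z theta <= F_z (Q eta) <= F_y eta] for every [eta], so
    [Q] sends [T x] and [T (Q x)] both into [T x] and into [T (Q x)]
    ([argmin_transfer]).  The theorem follows because [Q] is idempotent. *)

Section InnerProduct.
Context {R : realType} {n : nat} {ip : {dot 'cV[R]_n for idfun}}.

Lemma dot_sym (u v : 'cV[R]_n) : ip u v = ip v u.
Proof. by rewrite [LHS](hermC ip) expr0 mul1r. Qed.

Lemma dotBl (u v w : 'cV[R]_n) : ip (u - v) w = ip u w - ip v w.
Proof. exact: linearBl. Qed.

Lemma dotNr (u v : 'cV[R]_n) : ip u (- v) = - ip u v.
Proof. exact: linearNr. Qed.

Lemma dot_eq0 (u : 'cV[R]_n) : ip u u = 0 -> u = 0.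
Proof.
move=> u0; apply/eqP/negPn/negP => /(neq0_dnorm_gt0 (s := ip)).
by rewrite u0 ltxx.
Qed.

End InnerProduct.

Section OrthogonalProjection.
Context {R : realType} {n : nat} {ip : {dot 'cV[R]_n for idfun}}.
Context {Q : 'cV[R]_n -> 'cV[R]_n}.
Hypothesis hQ : orthogonal_projection ip Q.

(** Both sides equal [ip (Q u) (Q v)], as [u - Q u] and [v - Q v] are
    orthogonal to the range of [Q]. *)
Lemma orthogonal_projection_self_adjoint (u v : 'cV[R]_n) :
  ip (Q u) v = ip u (Q v).
Proof.
have [W QW] := hQ; have [Wu ou] := QW u; have [Wv ov] := QW v.
have /eqP := ou _ Wv; rewrite dotBl subr_eq0 => /eqP ->.
rewrite dot_sym [RHS]dot_sym.
by have /eqP := ov _ Wu; rewrite dotBl subr_eq0 => /eqP.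
Qed.

(** The definition of an orthogonal projection does not presuppose linearity:
    it comes from self-adjointness and nondegeneracy of the inner product. *)
Lemma orthogonal_projectionB : {morph Q : u v / u - v}.
Proof.
move=> u v; apply/eqP; rewrite -subr_eq0; apply/eqP/(@dot_eq0 _ _ ip).
by rewrite !dotBl !orthogonal_projection_self_adjoint !dotBl subrr.
Qed.

Lemma orthogonal_projection_idem (u : 'cV[R]_n) : Q (Q u) = Q u.
Proof.
have [W QW] := hQ; have [Wu _] := QW u; have [WQu oQu] := QW (Q u).
apply/eqP; rewrite eq_sym -subr_eq0; apply/eqP/(@dot_eq0 _ _ ip).
by apply: oQu; exact: rpredB.
Qed.

(** [Q] is additive and cannot tell [y] from [Q y]. *)
Lemma image_minus_set_proj (y : 'cV[R]_n) (C : set 'cV[R]_n) :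
  Q @` minus_set (Q y) C = Q @` minus_set y C.
Proof.
rewrite /minus_set !image_comp; apply: eq_imagel => c _ /=.
by rewrite !orthogonal_projectionB orthogonal_projection_idem.
Qed.

End OrthogonalProjection.

Section Objective.
Context {R : realType} {n : nat} (ip : {dot 'cV[R]_n for idfun}).

Lemma ereal_sup_shift (S : set (\bar R)) (r : R) :
  ereal_sup [set (r%:E + s)%E | s in S] = (r%:E + ereal_sup S)%E.
Proof.
apply/eqP; rewrite eq_le; apply/andP; split.
  apply: ge_ereal_sup => _ [s Ss <-].
  by rewrite leeD2lE// ereal_sup_ubound.
rewrite -leeBrDl//; apply: ge_ereal_sup => s Ss.
by rewrite leeBrDl//; apply: ereal_sup_ubound; exists s.
Qed.

Lemma expofam_objective_support A C (x theta : 'cV[R]_n) :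
  expofam_objective ip A C x theta
    = (A theta + support_fun ip (minus_set x C) (- theta))%E.
Proof.
rewrite /expofam_objective -addeA; congr (_ + _)%E.
rewrite -EFinN /support_fun -ereal_sup_shift /minus_set !image_comp.
congr ereal_sup; apply: eq_imagel => c _ /=.
by rewrite -EFinD dotNr dotBl opprB addrC.
Qed.

Lemma support_fun_self_adjoint (Q : 'cV[R]_n -> 'cV[R]_n) S theta :
  (forall u v, ip (Q u) v = ip u (Q v)) ->
  support_fun ip S (Q theta) = support_fun ip (Q @` S) theta.
Proof.
move=> Qadj; rewrite /support_fun image_comp; congr ereal_sup.
by apply: eq_imagel => s _ /=; rewrite Qadj.
Qed.

Lemma convex_efun_sublevel (f : 'cV[R]_n -> \bar R) (M : \bar R) :
  convex_efun f -> convex_set [set u | (f u <= M)%E].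
Proof.
move=> cf; apply/convex_setW => u v; rewrite !inE /= => fu fv k k0 k1.
rewrite inE /=; apply: (le_trans (cf _ _ _ k0 k1)).
have -> : M = (k%:num%:E * M + (1 - k%:num)%:E * M)%E.
  rewrite -ge0_muleDl ?lee_fin ?subr_ge0 ?ltW//.
  by rewrite -EFinD addrC subrK mul1e.
by apply: leeD; apply: lee_wpmul2l => //; rewrite lee_fin ?subr_ge0 ltW.
Qed.

(** The sublevel set of [f] at [f u] is convex and contains the orbit of [u],
    hence its convex hull. *)
Lemma convex_invariant_majorized (G : set 'M[R]_n) f u v :
  convex_efun f -> invariant_fun G f -> group_majorized G v u ->
  (f v <= f u)%E.
Proof.
move=> cf fG /(_ [set w | (f w <= f u)%E]); apply; split; first exact: convex_efun_sublevel.
by move=> _ [g Gg <-] /=; rewrite fG.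
Qed.

(** Two centers [y] and [z] are allowed because the theorem compares the
    objectives at [x] and at [Q x] in both directions. *)
Lemma expofam_objective_proj_le (Q : 'cV[R]_n -> 'cV[R]_n) A C y z theta :
  orthogonal_projection ip Q -> (A (Q theta) <= A theta)%E ->
  Q @` minus_set y C `<=` minus_set z C ->
  (expofam_objective ip A C y (Q theta) <= expofam_objective ip A C z theta)%E.
Proof.
move=> hQ AQ QC; rewrite !expofam_objective_support; apply: leeD => //.
have -> : - Q theta = Q (- theta).
  by rewrite -[- theta]sub0r -(subrr theta) !(orthogonal_projectionB hQ)
             subrr sub0r.
rewrite support_fun_self_adjoint; last exact: orthogonal_projection_self_adjoint.
by apply: ereal_sup_le; exact: image_subset.
Qed.

(** Passing through [Q] on both sides chains
    [g (Q u) <= f u <= f (Q v) <= g v]. *)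
Lemma argmin_transfer (Q : 'cV[R]_n -> 'cV[R]_n) (f g : 'cV[R]_n -> \bar R) :
  (forall u, (g (Q u) <= f u)%E) -> (forall u, (f (Q u) <= g u)%E) ->
  Q @` argmin f `<=` argmin g.
Proof.
move=> gf fg _ [u [fu minu] <-]; split; first exact: le_lt_trans (gf u) fu.
by move=> v; rewrite (le_trans (gf u))// (le_trans (minu (Q v))).
Qed.

End Objective.

Theorem theorem2 (R : realType) (n : nat) (ip : {dot 'cV[R]_n for idfun})
    (G : set 'M[R]_n) (A : 'cV[R]_n -> \bar R) (C : set 'cV[R]_n)
    (T : 'cV[R]_n -> set 'cV[R]_n) (x : 'cV[R]_n) (Q : 'cV[R]_n -> 'cV[R]_n)
    (hG : compact_orthogonal_subgroup ip G)
    (hT : expofam_type ip A C T)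
    (hA : invariant_fun G A)
    (hQ : orthogonal_projection ip Q)
    (averaging : forall u, group_majorized G (Q u) u)
    (dual_feasibility : Q @` minus_set x C `<=` minus_set x C)
    (dual_invariance : Q @` minus_set x C `<=` minus_set (Q x) C) :
  (Q @` T x = Q @` T (Q x) /\ Q @` T (Q x) `<=` T x `&` T (Q x)) /\
  (is_singleton (T x) ->
     [/\ Q @` T x = Q @` T (Q x),
         Q @` T (Q x) = T x,
         T x `<=` T (Q x) &
         is_singleton (T (Q x)) -> T x = T (Q x)]).
Proof.
have [[_ cA _] _ TE] := hT.
have Qidem := orthogonal_projection_idem hQ.
have AQ u : (A (Q u) <= A u)%E by exact: convex_invariant_majorized (averaging u).
have le_obj y z u : Q @` minus_set y C `<=` minus_set z C ->
    (expofam_objective ip A C y (Q u) <= expofam_objective ip A C z u)%E.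
  exact: expofam_objective_proj_le.
have dual_feasibilityQ : Q @` minus_set (Q x) C `<=` minus_set x C.
  by rewrite (image_minus_set_proj hQ).
have dual_invarianceQ : Q @` minus_set (Q x) C `<=` minus_set (Q x) C.
  by rewrite (image_minus_set_proj hQ).
have QTxx : Q @` T x `<=` T x.
  by rewrite !TE; apply: argmin_transfer => u; exact: le_obj.
have QTxQ : Q @` T x `<=` T (Q x).
  by rewrite !TE; apply: argmin_transfer => u; exact: le_obj.
have QTQx : Q @` T (Q x) `<=` T x.
  by rewrite !TE; apply: argmin_transfer => u; exact: le_obj.
have QTQQ : Q @` T (Q x) `<=` T (Q x).
  by rewrite !TE; apply: argmin_transfer => u; exact: le_obj.
(* Idempotence: an element [Q t] is its own preimage under [Q]. *)
have QTE : Q @` T x = Q @` T (Q x).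
  apply/seteqP; split=> _ [t Tt <-]; exists (Q t); rewrite ?Qidem//.
    by apply: QTxQ; exists t.
  by apply: QTQx; exists t.
split; first by split=> // u QTu; split; [exact: QTQx | exact: QTQQ].
move=> [t Tt].
have QTt : Q @` T x = T x.
  have Qt : Q t = t by have := QTxx (Q t); rewrite Tt; apply; exists t.
  by rewrite Tt image_set1 Qt.
have TTQ : T x `<=` T (Q x) by rewrite -QTt.
split=> //; first by rewrite -QTE.
by move=> [s Ts]; move: TTQ; rewrite Tt Ts => /(_ t erefl) /= ->.
Qed.
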